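(* Let $m\ge 2$, $k\ge 3$, and consider a system of ODEs $y^i_{k+1}=f^i(x,y^j_s)$, $i=1,\dots,m$, $0\le s\le k$, up to point transformations. Then the symmetric tensor \[ (I_2)^i_{jl}=\frac{\partial^2 f^i}{\partial y^j_k\,\partial y^l_k} \] is a relative differential invariant of degree $2$ of the system.
   Context: Coordinates on $J^{k+1}(\mathbb R,\mathbb R^m)$ are $(x,y^i_r)$, $0\le r\le k+1$, where $y^i_r$ stands for the $r$-th derivative of $y^i(x)$. Point transformations are local diffeomorphisms of $(x,y^1,\dots,y^m)$-space, acting on systems via prolongation. A relative invariant is a function of the right-hand sides $f^i$ and their derivatives, valued in a finite-dimensional representation, which transforms equivariantly under the prolonged action of point transformations. *)

(* Defs.v *)
From HB Require Import structures.
From mathcomp Require Import all_boot all_order all_algebra.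
From mathcomp Require Import all_classical all_reals all_analysis.
Import Order.TTheory GRing.Theory Num.Theory.
Import numFieldNormedType.Exports.
Local Open Scope ring_scope.
Local Open Scope classical_set_scope.

Fixpoint Ck {R : realType} {V : normedModType R} (n : nat) (U : set V)
  (h : V -> R) : Prop :=
  match n with
  | 0 => forall x, U x -> {for x, continuous h}
  | n'.+1 => (forall x, U x -> differentiable h x) /\
             forall v : V, Ck n' U (fun x => derive h x v)
  end.

Definition smooth_on {R : realType} {V : normedModType R} (U : set V)
  (h : V -> R) : Prop := forall n, Ck n U h.

(* Jet space J^n(R, R^m) realised as row vectors of length 1 + (n+1) m.     *)
(* Coordinate 0 is x; coordinate 1 + r*m + i is y^i_r (0 <= r <= n, i < m). *)
Notation jdim m n := ((n.+1 * m).+1)%N.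

Definition jix (m r i : nat) : nat := (1 + r * m + i)%N.

Definition jcoord {R : realType} {N : nat} (p : 'rV[R]_N.+1) (c : nat) : R :=
  p ord0 (inord c).

Definition ecoord {R : realType} {N : nat} (c : nat) : 'rV[R]_N.+1 :=
  delta_mx ord0 (inord c).

Definition pderiv {R : realType} {N : nat} (c : nat) (h : 'rV[R]_N.+1 -> R)
  : 'rV[R]_N.+1 -> R := fun p => derive h p (ecoord c).

Definition base {R : realType} (m n : nat) (p : 'rV[R]_(jdim m n))
  : 'rV[R]_(m.+1) := \row_(c < m.+1) p ord0 (inord c).

(* total derivative on J^(k+1), applied to functions not depending on y_(k+1) *)
Definition Dtot {R : realType} (m k : nat) (h : 'rV[R]_(jdim m k.+1) -> R)
  (p : 'rV[R]_(jdim m k.+1)) : R :=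
  pderiv 0 h p +
  \sum_(r < k.+1) \sum_(i < m) jcoord p (jix m r.+1 i) * pderiv (jix m r i) h p.

(* Point transformation phi : (x,y) |-> (X, Y^1..Y^m), pulled back to jets *)
Definition Xhat {R : realType} (m k : nat) (phi : 'rV[R]_(m.+1) -> 'rV[R]_(m.+1))
  (p : 'rV[R]_(jdim m k.+1)) : R := phi (base m k.+1 p) ord0 ord0.

Definition Yhat {R : realType} (m k : nat) (phi : 'rV[R]_(m.+1) -> 'rV[R]_(m.+1))
  (i : nat) (p : 'rV[R]_(jdim m k.+1)) : R := phi (base m k.+1 p) ord0 (inord i.+1).

Fixpoint ytil {R : realType} (m k : nat) (phi : 'rV[R]_(m.+1) -> 'rV[R]_(m.+1))
  (r i : nat) : 'rV[R]_(jdim m k.+1) -> R :=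
  match r with
  | 0 => Yhat m k phi i
  | r'.+1 => fun p => Dtot m k (ytil m k phi r' i) p / Dtot m k (Xhat m k phi) p
  end.

Definition ext {R : realType} (m k : nat) (q : 'rV[R]_(jdim m k)) (z : nat -> R)
  : 'rV[R]_(jdim m k.+1) :=
  \row_(c < jdim m k.+1)
     if (c < jdim m k)%N then q ord0 (inord c) else z (c - jdim m k)%N.

(* k-th prolongation pr^k phi, evaluated at a point of J^(k+1)
   (its value depends only on the k-jet part) *)
Definition prolong {R : realType} (m k : nat)
  (phi : 'rV[R]_(m.+1) -> 'rV[R]_(m.+1)) (p : 'rV[R]_(jdim m k.+1))
  : 'rV[R]_(jdim m k) :=
  \row_(c < jdim m k)
     if c == 0 :> nat then Xhat m k phi p
     else ytil m k phi (c.-1 %/ m) (c.-1 %% m) p.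

Definition Jmx {R : realType} (m k : nat) (phi : 'rV[R]_(m.+1) -> 'rV[R]_(m.+1))
  (p : 'rV[R]_(jdim m k.+1)) : 'M[R]_m :=
  \matrix_(i < m, j < m)
    (pderiv j.+1 (fun b => phi b ord0 (inord i.+1)) (base m k.+1 p)
     - ytil m k phi 1 i p * pderiv j.+1 (fun b => phi b ord0 ord0) (base m k.+1 p)).

Definition I2 {R : realType} (m k : nat) (f : nat -> 'rV[R]_(jdim m k) -> R)
  (a b c : nat) (q : 'rV[R]_(jdim m k)) : R :=
  pderiv (jix m k b) (pderiv (jix m k c) (f a)) q.

(* Main.v *)
Require Import Defs.
From HB Require Import structures.
From mathcomp Require Import all_boot all_order all_algebra.
From mathcomp Require Import all_classical all_reals all_analysis.
From mathcomp Require Import ring zify.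
Import Order.TTheory GRing.Theory Num.Theory.
Import numFieldNormedType.Exports.
Local Open Scope ring_scope.
Local Open Scope classical_set_scope.

(** Write D for the total derivative of X, and ytil_r for the r-th prolonged
    coordinate.  When h is of order r, its total derivative contains y_(r+1)
    only through the sum of y_(r+1)^a dh/dy_r^a; induction gives, for r >= 2,
    ytil_r = D^(-r) J y_r + (terms of order < r), where J and D are of order 1.
    For k >= 3 the same expansion shows that
    ytil_(k+1) = D^(-k-1) J y_(k+1) + (terms affine in y_k).
    Restricting g(pr phi) = ytil_(k+1) to the equation y_(k+1) = f and
    differentiating twice along y_k kills the affine terms and leaves
    D^(-2k) g''(J, J) = D^(-k-1) J f''. *)

(** * Calculus along lines *)

(** The obstacle is the second differentiation of g(pr phi): a general chain rule would produce
    second derivatives of pr phi and derivatives of the coefficients. Neither occurs, because on the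
    equation a move of q along y_k moves pr phi along a straight line: orders below k stay fixed,
    and order k moves with velocity D^(-k) J, a function of the first-order jet and hence constant
    during the move. Derivatives of g along the image line are then derivatives along the source
    line, and the argument compares restrictions to lines instead of composing differentials on jet
    space. Moving y_k also moves y_(k+1) = f, so order is expressed by comparing jets that agree
    below order r, with no condition on the higher coordinates. A genuine chain rule is used only
    for psi o phi = id. It makes J invertible, so that g'' can be isolated; clearing D^(-2k) against
    D^(-k-1) leaves the weight D^(k-1). *)

Section LineCalculus.
Context {R : realType}.

Lemma quotient_near_line {V V' W : normedModType R} {F : V -> W} {G : V' -> W}
    {x v y w} :
  (\forall t \near (0 : R), F (t *: v + x) = G (t *: w + y)) ->
  {near (0 : R)^', (fun t => t^-1 *: ((F \o shift x) (t *: v) - F x)) =1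
    (fun t => t^-1 *: ((G \o shift y) (t *: w) - G y))}.
Proof.
move=> FG; have := nbhs_singleton FG; rewrite !scale0r !add0r => FG0.
have FG' : \forall t \near (0 : R)^', F (t *: v + x) = G (t *: w + y).
  exact: nbhs_dnbhs.
by apply: filterS FG' => t /= FGt; rewrite FGt FG0.
Qed.

(** The two lines may lie in different spaces: this takes the place of the chain rule for every map
    that is affine along the line considered. *)
Lemma derive_line {V V' W : normedModType R} (F : V -> W) (G : V' -> W) x v y w :
  (\forall t \near (0 : R), F (t *: v + x) = G (t *: w + y)) ->
  'D_v F x = 'D_w G y.
Proof.
move=> /quotient_near_line FG; rewrite /derive; congr (lim _).
by apply/seteqP; split; apply: near_eq_cvg; apply: filterS FG => t.
Qed.

Lemma derivable_line {V V' W : normedModType R} (F : V -> W) (G : V' -> W)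
    x v y w :
  (\forall t \near (0 : R), F (t *: v + x) = G (t *: w + y)) ->
  derivable F x v -> derivable G y w.
Proof.
move=> /quotient_near_line FG; rewrite /derivable => /cvg_ex[l Fl].
apply/cvg_ex; exists l; apply: cvg_trans Fl.
by apply: near_eq_cvg; apply: filterS FG => t.
Qed.

Lemma derivable_line_continuous {V : normedModType R} (F : V -> R) x v :
  derivable F x v -> (fun t : R => F (t *: v + x)) @ (0 : R) --> F x.
Proof.
move=> /derivable1P/derivable1_diffP/differentiable_continuous cF.
by rewrite -[in X in _ --> X](add0r x) -(scale0r v).
Qed.

Lemma derive_quotient {V : normedModType R} (f g : V -> R) x v :
  derivable f x v -> derivable g x v -> g x != 0 ->
  'D_v (fun y => f y / g y) x = ('D_v f x - f x / g x * 'D_v g x) / g x.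
Proof.
move=> df dg g0; rewrite (deriveM df (derivableV g0 dg)) deriveV //.
by rewrite -![_ *: _]/(_ * _); field.
Qed.

(** Weaker than openness, and enough for directional derivatives. For the locus where the total
    derivative of X is nonzero, it follows from continuity along lines. *)
Definition linewise_open {V : normedModType R} (O : set V) :=
  forall x v, O x -> \forall t \near (0 : R), O (t *: v + x).

Lemma open_linewise_open {V : normedModType R} (O : set V) :
  open O -> linewise_open O.
Proof.
move=> oO x v Ox.
have cl : (fun t : R => t *: v + x) @ (0 : R) --> (x : V).
  rewrite -[in X in _ --> X](add0r x) -(scale0r v).
  by apply: cvgD; [apply: cvgZr_tmp; exact: cvg_id|exact: cvg_cst].
by apply: cl; exact: open_nbhs_nbhs.
Qed.

(* The directional counterpart of [Ck]: it only asks for directional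
   derivatives, so it is stable under substitution of affine maps along lines
   and only needs [linewise_open] domains. *)
Fixpoint Dk {V : normedModType R} (n : nat) (O : set V) (h : V -> R) : Prop :=
  match n with
  | 0 => True
  | n'.+1 => (forall x v, O x -> derivable h x v) /\
             forall v : V, Dk n' O (fun x => derive h x v)
  end.

Definition dsmooth {V : normedModType R} (O : set V) (h : V -> R) :=
  forall n, Dk n O h.

Section Closure.
Context {V : normedModType R} {O : set V}.
Hypothesis oO : linewise_open O.

Lemma eq_on_line (f g : V -> R) x v : (forall y, O y -> f y = g y) -> O x ->
  \forall t \near (0 : R), f (t *: v + x) = g (t *: v + x).
Proof. by move=> fg Ox; apply: filterS (oO _ v Ox) => t /fg. Qed.

Lemma eq_on_derive (f g : V -> R) x v : (forall y, O y -> f y = g y) -> O x ->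
  'D_v f x = 'D_v g x.
Proof. by move=> fg Ox; apply: derive_line; exact: eq_on_line. Qed.

Lemma eq_on_derivable (f g : V -> R) x v :
  (forall y, O y -> f y = g y) -> O x -> derivable f x v -> derivable g x v.
Proof. by move=> fg Ox; apply: derivable_line; exact: eq_on_line. Qed.

Lemma eq_on_Dk n (f g : V -> R) :
  (forall y, O y -> f y = g y) -> Dk n O f -> Dk n O g.
Proof.
elim: n f g => // n IH f g fg /= [df Df]; split=> [x v Ox|v].
  by apply: (eq_on_derivable f); rewrite ?fg //; exact: df.
by apply: IH (Df v) => y Oy; exact: eq_on_derive.
Qed.

Lemma DkW n (f : V -> R) : Dk n.+1 O f -> Dk n O f.
Proof.
elim: n f => // n IH f [df Df]; split=> // v; exact: IH (Df v).
Qed.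

Lemma Dk_cst n (c : R) : Dk n O (fun=> c).
Proof.
elim: n c => // n IH c; split=> [x v _|v]; first exact: derivable_cst.
apply: (@eq_on_Dk _ (fun=> 0)) (IH 0) => y _.
by symmetry; exact: derive_cst.
Qed.

Lemma DkD n (f g : V -> R) :
  Dk n O f -> Dk n O g -> Dk n O (fun x => f x + g x).
Proof.
elim: n f g => // n IH f g [df Df] [dg Dg]; split=> [x v Ox|v].
  by apply: derivableD; [exact: df|exact: dg].
apply: eq_on_Dk (IH _ _ (Df v) (Dg v)) => y Oy.
by symmetry; apply: deriveD; [exact: df|exact: dg].
Qed.

Lemma DkM n (f g : V -> R) :
  Dk n O f -> Dk n O g -> Dk n O (fun x => f x * g x).
Proof.
elim: n f g => // n IH f g Hf Hg.
have [[df Df] [dg Dg]] := (Hf, Hg); split=> [x v Ox|v].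
  by apply: derivableM; [exact: df|exact: dg].
apply: eq_on_Dk (DkD _ _ _ (IH _ _ (DkW _ _ Hf) (Dg v))
                       (IH _ _ (DkW _ _ Hg) (Df v))) => y Oy.
by symmetry; exact: (deriveM (df _ v Oy) (dg _ v Oy)).
Qed.

Lemma DkV n (f : V -> R) : (forall x, O x -> f x != 0) ->
  Dk n O f -> Dk n O (fun x => (f x)^-1).
Proof.
move=> f0; elim: n => // n IH Hf.
have [df Df] := Hf; split=> [x v Ox|v].
  by apply: derivableV; [exact: f0|exact: df].
have Hi := IH (DkW _ _ Hf).
apply: eq_on_Dk (DkM _ _ _ (DkM _ _ _ Hi Hi)
                  (DkM _ _ _ (Dk_cst n (-1)) (Df v))) => y Oy.
rewrite (deriveV (f0 _ Oy) (df _ v Oy)) /=.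
by rewrite expr2 invfM -[RHS]/(_ * _); ring.
Qed.

Lemma dsmoothD (f g : V -> R) :
  dsmooth O f -> dsmooth O g -> dsmooth O (fun x => f x + g x).
Proof. by move=> sf sg n; exact: DkD. Qed.

Lemma dsmoothM (f g : V -> R) :
  dsmooth O f -> dsmooth O g -> dsmooth O (fun x => f x * g x).
Proof. by move=> sf sg n; exact: DkM. Qed.

Lemma dsmoothV (f : V -> R) : (forall x, O x -> f x != 0) ->
  dsmooth O f -> dsmooth O (fun x => (f x)^-1).
Proof. by move=> f0 sf n; exact: DkV. Qed.

Lemma dsmooth_sum n (f : 'I_n -> V -> R) :
  (forall i, dsmooth O (f i)) -> dsmooth O (fun x => \sum_(i < n) f i x).
Proof.
elim: n f => [|n IH] f sf.
  by move=> N; apply: eq_on_Dk (Dk_cst N 0) => y _; rewrite big_ord0.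
move=> N; apply: eq_on_Dk (DkD _ _ _ (IH _ (fun i => sf (lift ord0 i)) N) (sf ord0 N)).
by move=> y _; rewrite big_ord_recl addrC.
Qed.

Lemma dsmooth_derive (f : V -> R) v :
  dsmooth O f -> dsmooth O (fun x => derive f x v).
Proof. by move=> sf n; have [_] := sf n.+1; apply. Qed.

Lemma dsmooth_derivable (f : V -> R) x v :
  dsmooth O f -> O x -> derivable f x v.
Proof. by move=> sf; have [] := sf 1%N => df _; exact: df. Qed.

End Closure.

Lemma Dk_subset {V : normedModType R} (O O' : set V) n (f : V -> R) :
  O' `<=` O -> Dk n O f -> Dk n O' f.
Proof.
move=> sO; elim: n f => // n IH f [df Df]; split=> [x v /sO|v]; first exact: df.
exact: IH (Df v).
Qed.

Lemma smooth_on_dsmooth {V : normedModType R} (O : set V) (f : V -> R) :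
  smooth_on O f -> dsmooth O f.
Proof.
move=> sf n; move: (sf n) => {sf}; elim: n f => // n IH f [df Df].
split=> [x v Ox|v]; first exact/diff_derivable/df.
exact/IH/Df.
Qed.

Lemma is_derive_affine (a c : R) : is_derive (0 : R) 1 (fun t => a + t * c) c.
Proof.
rewrite (_ : (fun t => _) = cst a + c *: id); last first.
  by apply/funext => t; rewrite mulrC.
by apply: is_derive_eq; rewrite add0r; exact: mulr1.
Qed.

(** Computes partial derivatives with no regularity assumed: an affine restriction to the line
    yields derivability and the slope together. *)
Lemma derive_affine_line {V : normedModType R} (F : V -> R) x v a c :
  (\forall t \near (0 : R), F (t *: v + x) = a + t * c) ->
  derivable F x v /\ 'D_v F x = c.
Proof.
move=> E; have [d1 d2] := is_derive_affine a c.
have E' : \forall t \near (0 : R),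
    a + (t *: 1 + 0) * c = F (t *: v + x).
  by apply: filterS E => t; rewrite addr0 -[t *: 1]/(t * 1) mulr1.
split; first exact: (@derivable_line R V R (fun t => a + t * c) F 0 1 x v E').
by rewrite -(@derive_line R V R (fun t => a + t * c) F 0 1 x v E').
Qed.

Lemma linear_dsmooth {V : normedModType R} (O : set V) (l : V -> R) :
  linewise_open O -> linear_for *%R l -> dsmooth O l.
Proof.
move=> oO ll [//|n].
have dl x v : derivable l x v /\ 'D_v l x = l v.
  by apply: (derive_affine_line _ _ _ (l x)); near=> t; rewrite ll addrC.
split=> [x v _|v]; first by have [] := dl x v.
apply: (eq_on_Dk oO) (Dk_cst oO n (l v)) => y _.
by have [] := dl y v.
Unshelve. all: by end_near. Qed.

Lemma dsmooth_precomp {V V' : normedModType R} (O : set V') (b : V -> V')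
    (h : V' -> R) :
  linear b -> dsmooth O h -> dsmooth (b @^-1` O) (h \o b).
Proof.
move=> lb sh n; move: {sh} (sh n); elim: n h => // n IH h [dh Dh].
have E x v t : (h \o b) (t *: v + x) = h (t *: b v + b x) by rewrite /= lb.
split=> [x v Ox|v].
  apply: (derivable_line h (h \o b) (b x) (b v)); last exact: dh.
  by near=> t; rewrite E.
rewrite (_ : (fun x => _) = (fun y => 'D_(b v) h y) \o b); first exact: IH (Dh _).
by apply/funext => x; apply: derive_line; near=> t; rewrite E.
Unshelve. all: by end_near. Qed.

End LineCalculus.

(** * Functions on jet space *)

Section Coordinates.
Context {R : realType}.

Lemma jcoord_line {N} (t : R) (v p : 'rV[R]_N.+1) c :
  jcoord (t *: v + p) c = t * jcoord v c + jcoord p c.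
Proof. by rewrite /jcoord !mxE. Qed.

Lemma jcoord_ecoord {N} c d : (c < N.+1)%N -> (d < N.+1)%N ->
  jcoord (ecoord d : 'rV[R]_N.+1) c = (c == d)%:R.
Proof.
move=> cN dN; rewrite /jcoord /ecoord mxE eqxx /= -val_eqE /=.
by rewrite !inordK.
Qed.

Lemma jcoordP {N} (p p' : 'rV[R]_N.+1) :
  (forall c, (c < N.+1)%N -> jcoord p c = jcoord p' c) -> p = p'.
Proof.
move=> E; apply/rowP => c.
by have := E c (ltn_ord c); rewrite /jcoord inord_val.
Qed.

Lemma jcoord_base m n (p : 'rV[R]_(jdim m n)) c :
  (c < m.+1)%N -> jcoord (base m n p) c = jcoord p c.
Proof. by move=> cm; rewrite /jcoord mxE inordK. Qed.

Lemma base_linear m n : linear (@base R m n).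
Proof. by move=> t v p; apply/rowP => c; rewrite !mxE. Qed.

Lemma base_ecoord m n d : (d < m.+1)%N ->
  base m n (ecoord d : 'rV[R]_(jdim m n)) = ecoord d.
Proof.
move=> dm; apply: jcoordP => c cm; rewrite jcoord_base // !jcoord_ecoord //.
all: apply: (leq_trans _ (_ : m.+1 <= jdim m n)%N) => //; nia.
Qed.

(** The first [(r * m).+1] coordinates are x and the blocks y_s with s < r. Level 1 is thus the base
    point, and level 2 the first-order jet. *)
Definition agree m {N} r (p p' : 'rV[R]_N.+1) :=
  forall c, (c < (r * m).+1)%N -> jcoord p c = jcoord p' c.

Lemma agree_sym m {N} r (p p' : 'rV[R]_N.+1) : agree m r p p' -> agree m r p' p.
Proof. by move=> A c cr; rewrite A. Qed.

Lemma agreeW m {N} r r' (p p' : 'rV[R]_N.+1) : (r' <= r)%N ->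
  agree m r p p' -> agree m r' p p'.
Proof. by move=> rr A c cr; apply: A; nia. Qed.

Lemma agree_line m {N} r (p p' : 'rV[R]_N.+1) t v :
  agree m r p p' -> agree m r (t *: v + p) (t *: v + p').
Proof. by move=> A c cr; rewrite !jcoord_line A. Qed.

Lemma agree_shift m {N} r (p : 'rV[R]_N.+1) t d :
  ((r * m).+1 <= d)%N -> (d < N.+1)%N -> agree m r (t *: ecoord d + p) p.
Proof.
move=> rd dN c cr; rewrite jcoord_line jcoord_ecoord //; last lia.
by rewrite (_ : (c == d) = false) ?mulr0 ?add0r //; lia.
Qed.

Lemma agree_base m n (p p' : 'rV[R]_(jdim m n)) :
  agree m 1 p p' -> base m n p = base m n p'.
Proof.
move=> A; apply: jcoordP => c cm; rewrite !jcoord_base // A //; lia.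
Qed.

End Coordinates.

(** * Order of a function and affine dependence on its top coordinates *)

Section Dependence.
Context {R : realType} (m k : nat).
Local Notation J := 'rV[R]_(jdim m k.+1).
Context (O : set J).
Hypothesis oO : linewise_open O.

(* [dep r h]: on [O], [h] only involves x and the y_s with s < r. *)
Definition dep r (h : J -> R) :=
  forall p p', O p -> O p' -> agree m r p p' -> h p = h p'.

Lemma depW r r' h : (r' <= r)%N -> dep r' h -> dep r h.
Proof. by move=> rr dh p p' Op Op' A; apply: dh => //; exact: agreeW A. Qed.

Lemma eq_dep r h h' : (forall p, O p -> h p = h' p) -> dep r h -> dep r h'.
Proof. by move=> E dh p p' Op Op' A; rewrite -!E //; exact: dh. Qed.

Lemma depM r h h' : dep r h -> dep r h' -> dep r (fun p => h p * h' p).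
Proof. by move=> d d' p p' Op Op' A; rewrite (d p p') // (d' p p'). Qed.

Lemma depV r h : dep r h -> dep r (fun p => (h p)^-1).
Proof. by move=> d p p' Op Op' A; rewrite (d p p'). Qed.

Lemma dep_jcoord r c : (c < (r * m).+1)%N -> dep r (fun p => jcoord p c).
Proof. by move=> cr p p' _ _; apply. Qed.

(** Parallel lines through two points that agree at level r keep agreeing, so the restrictions of
    [h] to them coincide near 0. *)
Lemma dep_pderiv r h d : dep r h -> dep r (pderiv d h).
Proof.
move=> dh p p' Op Op' A; apply: derive_line.
apply: filterS2 (oO p (ecoord d) Op) (oO p' (ecoord d) Op') => t Ot Ot'.
by apply: dh => //; exact: agree_line.
Qed.

Lemma dep_pderiv0 r h d p : dep r h -> ((r * m).+1 <= d)%N ->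
  (d < jdim m k.+1)%N -> O p -> pderiv d h p = 0.
Proof.
move=> dh rd dN Op.
have [|//] := derive_affine_line h p (ecoord d) (h p) 0.
apply: filterS (oO p (ecoord d) Op) => t Ot; rewrite mulr0 addr0.
by apply: dh => //; exact: agree_shift.
Qed.

(** For [h] of order r, the part of the total derivative without y_(r+1). It may still contain y_r,
    both through [h] and through the summand s = r - 1. *)
Definition Dlow r (h : J -> R) (p : J) : R :=
  pderiv 0 h p + \sum_(s < r) \sum_(i < m)
    jcoord p (jix m s.+1 i) * pderiv (jix m s i) h p.

Lemma dep_Dlow r h : dep r.+1 h -> dep r.+1 (Dlow r h).
Proof.
move=> dh p p' Op Op' A; rewrite /Dlow; congr (_ + _).
  exact: (dep_pderiv _ _ _ dh).
apply: eq_bigr => s _; apply: eq_bigr => i _; congr (_ * _).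
  by apply: A; rewrite /jix; have := ltn_ord s; have := ltn_ord i; nia.
exact: (dep_pderiv _ _ _ dh).
Qed.

Lemma Dtot_top r h p : dep r.+1 h -> (r <= k)%N -> O p ->
  Dtot m k h p = Dlow r h p +
    \sum_(i < m) jcoord p (jix m r.+1 i) * pderiv (jix m r i) h p.
Proof.
move=> dh rk Op; rewrite /Dtot /Dlow -addrA; congr (_ + _).
pose G s := \sum_(i < m) jcoord p (jix m s.+1 i) * pderiv (jix m s i) h p.
have G0 : \sum_(r.+1 <= s < k.+1) G s = 0.
  rewrite big_nat; apply: big1 => s /andP[rs sk]; apply: big1 => i _.
  rewrite (dep_pderiv0 r.+1) ?mulr0 // /jix; have := ltn_ord i; nia.
rewrite -(big_mkord xpredT G) (@big_cat_nat _ _ _ r.+1) //= G0 addr0.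
by rewrite big_nat_recr //= big_mkord.
Qed.

Lemma dep_Dtot r h : dep r.+1 h -> (r <= k)%N -> dep r.+2 (Dtot m k h).
Proof.
move=> dh rk p p' Op Op' A; rewrite !(Dtot_top r) //; congr (_ + _).
  by apply: dep_Dlow => //; exact: agreeW A.
apply: eq_bigr => i _; congr (_ * _).
  by apply: A; rewrite /jix; have := ltn_ord i; nia.
by apply: (dep_pderiv _ _ _ dh) => //; exact: agreeW A.
Qed.

Lemma dsmooth_jcoord c : dsmooth O (fun p : J => jcoord p c).
Proof.
by apply: linear_dsmooth => // t v p; exact: jcoord_line.
Qed.

Lemma dsmooth_Dtot h : dsmooth O h -> dsmooth O (Dtot m k h).
Proof.
move=> sh; apply: dsmoothD => //; first exact: dsmooth_derive.
apply: dsmooth_sum => // r; apply: dsmooth_sum => // i.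
by apply: dsmoothM => //; [exact: dsmooth_jcoord|exact: dsmooth_derive].
Qed.

(* [affine r h]: on [O], [h] is affine in the y_r, with coefficients that only
   involve x and the y_s with s < r, and it does not involve the y_s, s > r. *)
Definition affine_with r (h : J -> R) (K : 'I_m -> J -> R) :=
  (forall a, dep r (K a)) /\
  forall p p', O p -> O p' -> agree m r p p' ->
    h p' = h p + \sum_(a < m) (jcoord p' (jix m r a) - jcoord p (jix m r a)) * K a p.

Definition affine r h := exists K, affine_with r h K.

Lemma dep_affine r h : dep r h -> affine r h.
Proof.
move=> dh; exists (fun _ _ => 0); split=> // p p' Op Op' A.
by rewrite big1 ?addr0 => [|a _]; rewrite ?mulr0 // (dh p p').
Qed.

Lemma affineD r h h' : affine r h -> affine r h' -> affine r (fun p => h p + h' p).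
Proof.
move=> [K [dK HK]] [K' [dK' HK']]; exists (fun a p => K a p + K' a p); split.
  by move=> a p p' Op Op' A; rewrite (dK a p p') // (dK' a p p').
move=> p p' Op Op' A; rewrite (HK p p') // (HK' p p') //.
under [in RHS]eq_bigr do rewrite mulrDr.
by rewrite big_split /=; ring.
Qed.

Lemma affineM r u h : dep r u -> affine r h -> affine r (fun p => u p * h p).
Proof.
move=> du [K [dK HK]]; exists (fun a p => u p * K a p); split.
  by move=> a; exact: depM.
move=> p p' Op Op' A; rewrite (HK p p') // -(du p p') // mulrDr mulr_sumr.
by congr (_ + _); apply: eq_bigr => a _; ring.
Qed.

Lemma affine_sum r n (h : 'I_n -> J -> R) :
  (forall i, affine r (h i)) -> affine r (fun p => \sum_(i < n) h i p).
Proof.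
elim: n h => [|n IH] h ah.
  by apply: dep_affine => p p' _ _ _; rewrite !big_ord0.
rewrite (_ : (fun p => _) = (fun p => h ord0 p + \sum_(i < n) h (lift ord0 i) p)).
  by apply: affineD => //; exact: IH.
by apply/funext => p; rewrite big_ord_recl.
Qed.

Lemma affine_jcoord r i u : (i < m)%N -> dep r u ->
  affine r (fun p => jcoord p (jix m r i) * u p).
Proof.
move=> im du; exists (fun a p => (a == i :> nat)%:R * u p); split.
  by move=> a; apply: depM => //.
move=> p p' Op Op' A; rewrite (bigD1 (Ordinal im)) //= big1; last first.
  by move=> a; rewrite -val_eqE /= => /negPf ->; rewrite mul0r mulr0.
by rewrite eqxx mulr1n addr0 (du p p') //; ring.
Qed.

(** If p and p' agree at level r, the offsets [w] between their y_r stay constant along the parallel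
    lines through them. Hence [h] on the second line is the fixed combination h + sum w K on the
    first, which can be differentiated in any direction. *)
Lemma affine_pderiv r h K d : affine_with r h K -> dsmooth O h ->
  (forall a, dsmooth O (K a)) ->
  affine_with r (pderiv d h) (fun a => pderiv d (K a)).
Proof.
move=> [dK HK] sh sK; split=> [a|p p' Op Op' A]; first exact: dep_pderiv.
pose w (a : 'I_m) : R := jcoord p' (jix m r a) - jcoord p (jix m r a).
pose h' := h + \sum_(a < m) w a *: K a.
have dw a : derivable (w a *: K a) p (ecoord d).
  by apply: derivableZ; exact: (dsmooth_derivable _ _ _ (sK a)).
have -> : pderiv d h p' = 'D_(ecoord d) h' p.
  apply: derive_line.
  apply: filterS2 (oO p (ecoord d) Op) (oO p' (ecoord d) Op') => t Ot Ot'.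
  rewrite (HK _ _ Ot Ot') /h' /=; last exact: agree_line.
  rewrite fctE fct_sumE; congr (_ + _); apply: eq_bigr => a _.
  rewrite !jcoord_line [RHS]/(_ * _); congr (_ * _); rewrite /w; ring.
rewrite /h' deriveD ?derive_sum //; last 2 first.
- exact: (dsmooth_derivable _ _ _ sh).
- exact: derivable_sum.
congr (_ + _); apply: eq_bigr => a _.
by rewrite deriveZ //; exact: (dsmooth_derivable _ _ _ (sK a)).
Qed.

End Dependence.

(** * Prolonged coordinates *)

Section Prolongation.
Context {R : realType} (m k : nat) (phi : 'rV[R]_m.+1 -> 'rV[R]_m.+1).
Context (U : set 'rV[R]_m.+1).
Local Notation J := 'rV[R]_(jdim m k.+1).
Local Notation D := (Dtot m k (Xhat m k phi)).
Local Notation y r a p := (jcoord p (jix m r a)).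

Definition jets_over : set J := base m k.+1 @^-1` U.

(** The domain of the prolongation: where the total derivative of X vanishes, the quotients in
    [ytil] take the default value 0. *)
Definition regular_jets : set J :=
  [set p | U (base m k.+1 p) /\ D p != 0].

Local Notation O := regular_jets.

Hypothesis oU : open U.
Hypothesis sphi : forall c : 'I_m.+1, dsmooth U (fun b => phi b ord0 c).

Lemma linewise_open_jets_over : linewise_open jets_over.
Proof.
move=> p v Up.
apply: filterS (open_linewise_open _ oU _ (base m k.+1 v) Up) => t.
by rewrite /jets_over /= base_linear.
Qed.

Lemma dsmooth_Xhat : dsmooth jets_over (Xhat m k phi).
Proof. exact: dsmooth_precomp (@base_linear R m k.+1) (sphi ord0). Qed.

Lemma dsmooth_Yhat i : dsmooth jets_over (Yhat m k phi i).
Proof. exact: dsmooth_precomp (@base_linear R m k.+1) (sphi (inord i.+1)). Qed.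

Lemma dsmooth_DXhat : dsmooth jets_over D.
Proof. exact: (dsmooth_Dtot m k _ linewise_open_jets_over _ dsmooth_Xhat). Qed.

Lemma regular_jets_sub : O `<=` jets_over.
Proof. by move=> p []. Qed.

Lemma linewise_open_regular : linewise_open O.
Proof.
move=> p v [Up Dp].
have cD := derivable_line_continuous _ _ _
  (dsmooth_derivable _ p v dsmooth_DXhat Up).
have D0 : \forall t \near (0 : R), D (t *: v + p) != 0.
  by apply: (cvgr_neq0 _ cD).
by apply: filterS2 (linewise_open_jets_over p v Up) D0.
Qed.
Let oO := linewise_open_regular.

Lemma dep_Xhat (O' : set J) : dep m k O' 1 (Xhat m k phi).
Proof. by move=> p p' _ _ A; rewrite /Xhat (agree_base _ _ p p'). Qed.

Lemma dep_Yhat (O' : set J) i : dep m k O' 1 (Yhat m k phi i).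
Proof. by move=> p p' _ _ A; rewrite /Yhat (agree_base _ _ p p'). Qed.

(** Membership is a condition on the first-order jet, so coordinates of order at least 2 can be
    moved arbitrarily far without leaving the set. *)
Lemma regular_agree p p' : agree m 2 p p' -> O p -> O p'.
Proof.
move=> A [Up Dp].
have Up' : jets_over p'.
  by rewrite /jets_over /= -(agree_base _ _ p p') //; exact: agreeW A.
split=> //; rewrite -(dep_Dtot m k _ linewise_open_jets_over 0 _ _ _ p p') //.
exact: dep_Xhat.
Qed.

Lemma dep_DXhat : dep m k O 2 D.
Proof. exact: (dep_Dtot m k O oO 0 _ (dep_Xhat _)). Qed.

Lemma dsmooth_DXhatV : dsmooth O (fun p => (D p)^-1).
Proof.
apply: dsmoothV => //; first by move=> p [].
by move=> n; exact: Dk_subset regular_jets_sub (dsmooth_DXhat n).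
Qed.

Lemma dsmooth_ytil r i : dsmooth O (ytil m k phi r i).
Proof.
elim: r => [|r IH] /=.
  by move=> n; exact: Dk_subset regular_jets_sub (dsmooth_Yhat i n).
by apply: dsmoothM; [|exact: dsmooth_Dtot|exact: dsmooth_DXhatV].
Qed.

Lemma dep_ytil r i : (r <= k.+1)%N -> dep m k O r.+1 (ytil m k phi r i).
Proof.
elim: r => [|r IH] rk /=; first exact: dep_Yhat.
apply: depM; first exact: dep_Dtot (IH (ltnW rk)) _.
by apply: depV; apply: depW dep_DXhat.
Qed.

Lemma ytilS r i p : (r <= k)%N -> O p ->
  ytil m k phi r.+1 i p = Dlow m k r (ytil m k phi r i) p / D p +
   \sum_(a < m) y r.+1 a p * (pderiv (jix m r a) (ytil m k phi r i) p / D p).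
Proof.
move=> rk Op; rewrite /= (Dtot_top m k O oO r) //; last first.
  by apply: dep_ytil; exact: leqW.
rewrite mulrDl; congr (_ + _); rewrite mulr_suml.
by apply: eq_bigr => a _; rewrite mulrA.
Qed.

(* In the expansion [ytilS] nothing but the explicit y_(r+1) depends on y_(r+1). *)
Lemma affine_ytil r i : (1 <= r <= k)%N ->
  affine_with m k O r.+1 (ytil m k phi r.+1 i)
    (fun a p => pderiv (jix m r a) (ytil m k phi r i) p / D p).
Proof.
move=> /andP[r1 rk]; have dy := dep_ytil r i (leqW rk).
have dDV : dep m k O r.+1 (fun p => (D p)^-1).
  by apply: depV; apply: depW dep_DXhat.
have dK a : dep m k O r.+1 (fun p => pderiv (jix m r a) (ytil m k phi r i) p / D p).
  by apply: depM => //; exact: dep_pderiv.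
split=> [//|p p' Op Op' A]; rewrite (ytilS r i p rk Op) (ytilS r i p' rk Op').
rewrite -addrA; congr (_ + _).
  by symmetry; apply: (depM m k O _ _ _ (dep_Dlow m k O oO _ _ dy) dDV).
rewrite -big_split; apply: eq_bigr => a _ /=.
rewrite -(dK a p p') //; ring.
Qed.

Lemma jix_lt r a n : (a < m)%N -> (r <= n)%N -> (jix m r a < jdim m n)%N.
Proof. rewrite /jix; nia. Qed.

Lemma jcoord_shift r (a b : 'I_m) (t : R) p : (r <= k.+1)%N ->
  y r a (t *: ecoord (jix m r b) + p : J) = t * (a == b)%:R + y r a p.
Proof.
move=> rk; rewrite jcoord_line jcoord_ecoord ?jix_lt //.
by rewrite /jix eqn_add2l.
Qed.

Lemma agree_shift_top r (b : 'I_m) (t : R) (p : J) : (r <= k.+1)%N ->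
  agree m r (t *: ecoord (jix m r b) + p) p.
Proof.
by move=> rk; apply: agree_shift; rewrite ?jix_lt // /jix; lia.
Qed.

Lemma affine_shift r h K (b : 'I_m) t p : (2 <= r <= k.+1)%N ->
  affine_with m k O r h K -> O p ->
  h (t *: ecoord (jix m r b) + p) = h p + t * K b p.
Proof.
move=> /andP[r2 rk] [dK HK] Op.
have A : agree m r (t *: ecoord (jix m r b) + p) p by exact: agree_shift_top.
have Op' : O (t *: ecoord (jix m r b) + p).
  by apply: regular_agree Op; apply/agree_sym/(agreeW _ _ _ _ _ r2).
rewrite (HK p) //; last exact: agree_sym.
congr (_ + _); rewrite (bigD1 b) //= big1 ?addr0 => [|a ab].
  by rewrite jcoord_shift // eqxx mulr1 addrK.
by rewrite jcoord_shift // (negPf ab) mulr0 add0r subrr mul0r.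
Qed.

Lemma affine_with_pderiv r h K (b : 'I_m) p : (2 <= r <= k.+1)%N ->
  affine_with m k O r h K -> O p -> pderiv (jix m r b) h p = K b p.
Proof.
move=> rk aK Op.
have [|_ //] := derive_affine_line h p (ecoord (jix m r b)) (h p) (K b p).
by near=> t; exact: affine_shift.
Unshelve. all: by end_near. Qed.

(** Raising the order only divides the top coefficient by [D]. The step from order 0 to order 1 is
    excluded: there [D] itself involves y_1, and the quotient is not affine in general. *)
Lemma pderiv_ytilS r i (a : 'I_m) p : (1 <= r <= k)%N -> O p ->
  pderiv (jix m r.+1 a) (ytil m k phi r.+1 i) p =
  pderiv (jix m r a) (ytil m k phi r i) p / D p.
Proof.
move=> rk Op; rewrite (affine_with_pderiv _ _ _ _ _ _ (affine_ytil _ _ rk)) //; lia.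
Qed.

Lemma pderiv_base (h : 'rV[R]_m.+1 -> R) d (p : J) : (d < m.+1)%N ->
  pderiv d (fun p => h (base m k.+1 p)) p = pderiv d h (base m k.+1 p).
Proof.
move=> dm; apply: derive_line; near=> t.
by rewrite base_linear base_ecoord.
Unshelve. all: by end_near. Qed.

(** The commutator of d/dy_1 with the total derivative is d/dy_0, and d/dy_1 kills a function of the
    base point. *)
Lemma pderiv_Dtot_base (h : J -> R) (b : 'I_m) p : O p -> dep m k O 1 h ->
  pderiv (jix m 1 b) (Dtot m k h) p = pderiv (jix m 0 b) h p.
Proof.
move=> Op dh.
have [|_ //] := derive_affine_line (Dtot m k h) p (ecoord (jix m 1 b))
  (Dtot m k h p) (pderiv (jix m 0 b) h p).
apply: filterS (oO p (ecoord (jix m 1 b)) Op) => t Ot.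
have A : agree m 1 (t *: ecoord (jix m 1 b) + p) p by exact: agree_shift_top.
rewrite !(Dtot_top m k O oO 0) // (dep_Dlow m k O oO 0 _ dh _ p) // -[RHS]addrA.
apply: (congr1 (fun z => Dlow m k 0 h p + z)).
rewrite [LHS](eq_bigr (fun a : 'I_m => y 1 a p * pderiv (jix m 0 a) h p +
  t * (a == b)%:R * pderiv (jix m 0 a) h p)); last first.
  move=> a _; rewrite jcoord_shift // (dep_pderiv m k O oO _ _ _ dh _ p) //.
  by rewrite addrC mulrDl.
rewrite big_split /=; congr (_ + _).
rewrite (bigD1 b) //= big1 ?addr0 => [|a /negPf ->]; last by rewrite mulr0 mul0r.
by rewrite eqxx mulr1.
Qed.

(** The quotient rule gives (Y_y - (DY/DX) X_y) / DX, where DY/DX is [ytil] of order 1; [Jmx] is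
    exactly this numerator. *)
Lemma pderiv_ytil1 (i a : 'I_m) p : O p ->
  pderiv (jix m 1 a) (ytil m k phi 1 i) p = Jmx m k phi p i a / D p.
Proof.
move=> Op; have D0 : D p != 0 by case: Op.
have sD : dsmooth O D.
  by move=> n; exact: Dk_subset regular_jets_sub (dsmooth_DXhat n).
have sN : dsmooth O (Dtot m k (Yhat m k phi i)).
  by apply: dsmooth_Dtot => //; exact: (dsmooth_ytil 0 i).
have dD : derivable D p (ecoord (jix m 1 a)) by exact: dsmooth_derivable sD Op.
have dN : derivable (Dtot m k (Yhat m k phi i)) p (ecoord (jix m 1 a)).
  exact: dsmooth_derivable sN Op.
rewrite mxE {1}/pderiv /ytil derive_quotient //.
have -> : 'D_(ecoord (jix m 1 a)) (Dtot m k (Yhat m k phi i)) p =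
    pderiv (jix m 0 a) (Yhat m k phi i) p.
  exact: pderiv_Dtot_base Op (dep_Yhat O i).
have -> : 'D_(ecoord (jix m 1 a)) D p = pderiv (jix m 0 a) (Xhat m k phi) p.
  exact: pderiv_Dtot_base Op (dep_Xhat O).
have -> : jix m 0 a = a.+1 by rewrite /jix mul0n addn0 add1n.
have am : (a.+1 < m.+1)%N by rewrite ltnS.
by rewrite (pderiv_base (fun b => phi b ord0 (inord i.+1)) _ _ am)
  (pderiv_base (fun b => phi b ord0 ord0) _ _ am).
Qed.

Lemma pderiv_ytil r (i a : 'I_m) p : (1 <= r <= k.+1)%N -> O p ->
  pderiv (jix m r a) (ytil m k phi r i) p = Jmx m k phi p i a / D p ^+ r.
Proof.
elim: r => // -[|r] IH rk Op; first exact: pderiv_ytil1.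
rewrite pderiv_ytilS // IH //; last lia.
by rewrite [in RHS]exprSr invfM mulrA.
Qed.

(** The recursion only brings in further factors 1/D, so the top coefficient remains of order 1 for
    every r. It is therefore constant along y_k and can be pulled out of both differentiations. *)
Lemma dep_pderiv_ytil r i (a : 'I_m) : (1 <= r <= k.+1)%N ->
  dep m k O 2 (pderiv (jix m r a) (ytil m k phi r i)).
Proof.
elim: r => [|[|r] IH] rk; first by exfalso; lia.
  by apply: (dep_pderiv m k O oO 2); exact: dep_ytil.
apply: (eq_dep m k O _ _ _ (fun p Op => esym (pderiv_ytilS r.+1 i a p _ Op))) => //.
by apply: depM; [apply: IH; lia|apply: depV; exact: dep_DXhat].
Qed.

Lemma affine_ytil_pderiv r i : (2 <= r <= k.+1)%N ->
  affine_with m k O r (ytil m k phi r i)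
    (fun a => pderiv (jix m r a) (ytil m k phi r i)).
Proof.
case: r => [|r] rk; first by exfalso; lia.
have rk' : (1 <= r <= k)%N by lia.
have [dK HK] := affine_ytil r i rk'.
split=> [a|p p' Op Op' A].
  by apply: depW (dep_pderiv_ytil r.+1 i a _) => //; lia.
rewrite (HK p p') //; congr (_ + _); apply: eq_bigr => a _.
by rewrite pderiv_ytilS //; lia.
Qed.

(* This is where k >= 3 enters: the top coefficient of ytil_k only involves
   first order jets, so it does not contribute y_k^2 through y_k * d/dy_(k-1). *)
Lemma affine_Dlow_ytil i : (3 <= k)%N ->
  affine m k O k (fun p => Dlow m k k (ytil m k phi k i) p / D p).
Proof.
move=> k3.
pose Y := ytil m k phi k i.
have aY : affine_with m k O k Y (fun a => pderiv (jix m k a) Y).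
  by apply: affine_ytil_pderiv; lia.
have aP d : affine_with m k O k (pderiv d Y)
    (fun a => pderiv d (pderiv (jix m k a) Y)).
  apply: affine_pderiv => //; first exact: dsmooth_ytil.
  by move=> a; apply: dsmooth_derive; exact: dsmooth_ytil.
rewrite (_ : (fun p => _) = fun p => (D p)^-1 * Dlow m k k Y p); last first.
  by apply/funext => p; rewrite mulrC.
apply: affineM; first by apply: depV; apply: depW dep_DXhat; lia.
apply: affineD; first by exists (fun a => pderiv 0 (pderiv (jix m k a) Y)).
apply: affine_sum => s; apply: affine_sum => j.
(* For s + 1 < k the factor y_(s+1) is a coefficient of order below k. For s = k - 1 the factor y_k
   is itself the affine variable, so its cofactor must be free of y_k. *)
have [sk|sk] := ltnP s.+1 k.
  apply: affineM.
    by apply: dep_jcoord; rewrite /jix; have := ltn_ord j; nia.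
  by exists (fun a => pderiv (jix m s j) (pderiv (jix m k a) Y)).
have ks : k = s.+1 by apply/eqP; rewrite eqn_leq sk ltn_ord.
rewrite -[in X in affine _ _ _ _ X]ks; apply: affine_jcoord => //.
move=> p p' Op Op' A; have [_ HK] := aP (jix m s j).
rewrite (HK p p') // big1 ?addr0 // => a _.
(* The y_k-coefficient of dY/dy_(k-1) is a y_(k-1)-derivative of a function of order 1; it vanishes
   because k - 1 >= 2. *)
rewrite (dep_pderiv0 m k O oO 2) ?mulr0 //.
- by apply: dep_pderiv_ytil; lia.
- rewrite /jix; nia.
- by apply: jix_lt => //; lia.
Qed.

End Prolongation.

(** * Invertibility of J and restriction to the equation *)

Lemma jcoord_sum {R : realType} {N n} (v : 'I_n -> 'rV[R]_N.+1) c :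
  jcoord (\sum_(i < n) v i) c = \sum_(i < n) jcoord (v i) c.
Proof. by rewrite /jcoord summxE. Qed.

Lemma jcoordZ {R : realType} {N} (t : R) (v : 'rV[R]_N.+1) c :
  jcoord (t *: v) c = t * jcoord v c.
Proof. by rewrite /jcoord !mxE. Qed.

Section Jacobian.
Context {R : realType}.

Lemma differentiable_rV {V : normedModType R} n (F : V -> 'rV[R]_n) x :
  (forall c, differentiable (fun y => F y ord0 c) x) -> differentiable F x.
Proof.
move=> dF.
rewrite (_ : F = \sum_(c < n) (fun y => F y ord0 c *: delta_mx ord0 c)).
  by apply: differentiable_sum => c; exact: differentiableZl.
by apply/funext => y; rewrite fct_sumE -row_sum_delta.
Qed.

(** Along the line, psi o phi = id has slope v, while the chain rule gives the slope d psi (d phi v)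
    = d psi 0 = 0. *)
Lemma derive_left_inverse_inj n (phi psi : 'rV[R]_n.+1 -> 'rV[R]_n.+1)
    (U : set 'rV[R]_n.+1) b v :
  linewise_open U -> U b -> (forall b, U b -> psi (phi b) = b) ->
  (forall c, differentiable (fun y => phi y ord0 c) b) ->
  (forall c, differentiable (fun y => psi y ord0 c) (phi b)) ->
  (forall c, 'D_v (fun y => phi y ord0 c) b = 0) -> v = 0.
Proof.
move=> oU Ub pK dphi dpsi v0.
have dp := differentiable_rV _ _ _ dphi.
have dv0 : 'd phi b v = 0.
  rewrite -deriveE // derive_mx; last exact: diff_derivable.
  by apply/rowP => c; rewrite !mxE v0.
apply/rowP => c; rewrite mxE.
have [|_ <-] := derive_affine_line ((fun y => psi y ord0 c) \o phi) b v
  (b ord0 c) (v ord0 c).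
  by apply: filterS (oU b v Ub) => t Ut; rewrite /= pK // !mxE addrC.
rewrite deriveE; last exact: differentiable_comp.
by rewrite diff_comp //= dv0 linear0.
Qed.

Context (m k : nat) (phi psi : 'rV[R]_m.+1 -> 'rV[R]_m.+1).
Context (U : set 'rV[R]_m.+1).
Local Notation D := (Dtot m k (Xhat m k phi)).
Local Notation y r a p := (jcoord p (jix m r a)).

Lemma Dtot_base (h : 'rV[R]_m.+1 -> R) p :
  Dtot m k (fun p => h (base m k.+1 p)) p = pderiv 0 h (base m k.+1 p) +
    \sum_(a < m) y 1 a p * pderiv a.+1 h (base m k.+1 p).
Proof.
rewrite (Dtot_top m k setT _ 0) //; last 2 first.
- by move=> x v _; near=> t.
- by move=> p1 p2 _ _ A; rewrite (agree_base _ _ p1 p2).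
rewrite /Dlow big_ord0 addr0 pderiv_base //; congr (_ + _).
apply: eq_bigr => a _; rewrite pderiv_base // /jix; have := ltn_ord a; lia.
Unshelve. all: by end_near. Qed.

(* A kernel vector w of J is absorbed by the total derivative direction
   (1, y_1): d phi kills (0, w) - (X_y w / D) (1, y_1), which must vanish. *)
Lemma Jmx_unit p : linewise_open U -> regular_jets m k phi U p ->
  (forall b, U b -> psi (phi b) = b) ->
  (forall c, differentiable (fun y => phi y ord0 c) (base m k.+1 p)) ->
  (forall c, differentiable (fun y => psi y ord0 c) (phi (base m k.+1 p))) ->
  Jmx m k phi p \in unitmx.
Proof.
move=> oU [Ub D0] pK dphi dpsi; set b := base m k.+1 p in Ub dphi dpsi.
(* Transposing turns the row vector supplied by [det0P] into a right kernel vector of J. *)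
rewrite -unitmx_tr unitmxE unitfE; apply/negP => /det0P[w w0 wJ].
move/negP: w0; apply; apply/eqP/rowP => a0; rewrite [RHS]mxE.
pose X b := phi b ord0 ord0; pose Y (i : 'I_m) b := phi b ord0 (inord i.+1).
pose c := \sum_(a < m) w ord0 a * pderiv a.+1 X b.
pose v : 'rV[R]_m.+1 := \sum_(a < m) w ord0 a *: ecoord a.+1
  - (c / D p) *: (ecoord 0 + \sum_(a < m) y 1 a p *: ecoord a.+1).
have dv h : differentiable h b -> 'D_v h b =
    \sum_(a < m) w ord0 a * pderiv a.+1 h b
    - (c / D p) * Dtot m k (fun p => h (base m k.+1 p)) p.
  move=> dh; rewrite Dtot_base deriveE // linearB linearZ linearD !linear_sum /=.
  rewrite /pderiv !deriveE //; congr (_ - _ * (_ + _)).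
    by apply: eq_bigr => a _; rewrite linearZ /= deriveE.
  by apply: eq_bigr => a _; rewrite linearZ /= deriveE.
have v0 : v = 0.
  apply: (derive_left_inverse_inj _ phi psi U b) => // j.
  case: (unliftP ord0 j) => [i|] ->; last first.
    rewrite dv // -[\sum_(a < m) _]/c -[Dtot _ _ _ _]/(D p).
    by rewrite divfK ?subrr.
  have -> : lift ord0 i = inord i.+1.
    by apply/val_inj; rewrite /= inordK // ltnS.
  rewrite dv //; have := congr1 (fun M : 'rV[R]_m => M ord0 i) wJ.
  rewrite !mxE => E; rewrite -[RHS]E -mulrA [_^-1 * _]mulrC.
  rewrite -[_ / D p]/(ytil m k phi 1 i p) /c mulr_suml -sumrB.
  by apply: eq_bigr => a _; rewrite !mxE; ring.
have jv d : (d < m.+1)%N -> jcoord v d =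
   \sum_(a < m) w ord0 a * (d == a.+1)%:R
   - (c / D p) * ((d == 0%N)%:R + \sum_(a < m) y 1 a p * (d == a.+1)%:R).
  move=> dm; rewrite /v addrC -scaleNr jcoord_line addrC mulNr.
  congr (_ - _ * _).
    rewrite jcoord_sum; apply: eq_bigr => a _.
    by rewrite jcoordZ jcoord_ecoord // ltnS.
  rewrite -[ecoord 0]scale1r jcoord_line mul1r jcoord_ecoord //; congr (_ + _).
  rewrite jcoord_sum; apply: eq_bigr => a _.
  by rewrite jcoordZ jcoord_ecoord // ltnS.
(* Coordinate 0 of [v] is -c/D, so v = 0 removes the correction term; coordinate a0 + 1 then
   isolates the entry of [w] at [a0]. *)
have cD : c / D p = 0.
  have := jv 0%N isT; rewrite v0 !big1 ?addr0 ?mulr1 ?sub0r; first last.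
  - by move=> a _; rewrite mulr0.
  - by move=> a _; rewrite mulr0.
  by rewrite /jcoord mxE => /esym/eqP; rewrite oppr_eq0 => /eqP.
have := jv a0.+1 _; rewrite cD mul0r subr0 v0 {1}/jcoord mxE (bigD1 a0) //= big1.
  by rewrite eqxx mulr1 addr0 => ->//; rewrite ltnS.
by move=> a /negPf aa; rewrite eqSS eq_sym val_eqE aa mulr0.
Qed.

End Jacobian.

(** * Moving along y_k on the equation *)

Section Extension.
Context {R : realType} (m k : nat).
Local Notation y r a p := (jcoord p (jix m r a)).

Lemma jcoord_ext q (z : nat -> R) c :
  (c < jdim m k)%N -> jcoord (ext m k q z) c = jcoord q c.
Proof. by move=> cm; rewrite /jcoord mxE inordK ?cm //; nia. Qed.

Lemma jcoord_ext_top q (z : nat -> R) i : (i < m)%N ->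
  y k.+1 i (ext m k q z) = z i.
Proof.
move=> im; rewrite /jcoord mxE inordK; last by rewrite /jix; nia.
rewrite ifF; last by rewrite /jix; nia.
by congr z; rewrite /jix; nia.
Qed.

Lemma base_ext q (z : nat -> R) : base m k.+1 (ext m k q z) = base m k q.
Proof.
apply: jcoordP => c cm; rewrite !jcoord_base // jcoord_ext //; nia.
Qed.

(** The top values [z] and [z'] are unrelated on purpose: when q moves along y_k, the value y_(k+1)
    = f(q) moves too. *)
Lemma agree_ext_shift q (z z' : nat -> R) (b : 'I_m) t :
  agree m k (ext m k q z) (ext m k (t *: ecoord (jix m k b) + q) z').
Proof.
move=> c ck; have cl : (c < jdim m k)%N by nia.
rewrite !jcoord_ext //; apply/esym/(agree_shift m k) => //; first by rewrite /jix; lia.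
by rewrite /jix; have := ltn_ord b; nia.
Qed.

Lemma jcoord_ext_shift q (z z' : nat -> R) (a b : 'I_m) t :
  y k a (ext m k (t *: ecoord (jix m k b) + q) z') - y k a (ext m k q z) =
  t * (a == b)%:R.
Proof.
have jl (c : 'I_m) : (jix m k c < jdim m k)%N.
  by rewrite /jix; have := ltn_ord c; nia.
by rewrite !jcoord_ext // jcoord_line jcoord_ecoord // addrK /jix eqn_add2l.
Qed.

Context (phi : 'rV[R]_m.+1 -> 'rV[R]_m.+1) (U : set 'rV[R]_m.+1).
Local Notation O := (regular_jets m k phi U).
Hypothesis oU : open U.
Hypothesis sphi : forall c : 'I_m.+1, dsmooth U (fun b => phi b ord0 c).

Lemma affine_ext_shift h K q (z z' : nat -> R) (b : 'I_m) t : (2 <= k)%N ->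
  affine_with m k O k h K -> O (ext m k q z) ->
  h (ext m k (t *: ecoord (jix m k b) + q) z') = h (ext m k q z) + t * K b (ext m k q z).
Proof.
move=> k2 [_ HK] Op; have A := agree_ext_shift q z z' b t.
rewrite (HK (ext m k q z)) //; last first.
  by apply: (regular_agree _ _ _ _ _ _ _ _ Op) => //; exact: agreeW A.
congr (_ + _); rewrite (bigD1 b) //= big1 ?addr0 => [|a /negPf ab].
  by rewrite jcoord_ext_shift eqxx mulr1.
by rewrite jcoord_ext_shift ab mulr0 mul0r.
Qed.

(** On regular jets, the image of d/dy_k^b under the differential of the prolongation: column b of
    D^(-k) J, placed in the block of order k. *)
Definition prolong_dir (b : nat) p : 'rV[R]_(jdim m k) :=
  \sum_(j < m) pderiv (jix m k b) (ytil m k phi k j) p *: ecoord (jix m k j).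

(** Coordinates of order below k do not see the move, and those of order k are affine in y_k since k
    >= 2. *)
Lemma prolong_ext_shift q (z z' : nat -> R) (b : 'I_m) t : (2 <= k)%N ->
  O (ext m k q z) ->
  prolong m k phi (ext m k (t *: ecoord (jix m k b) + q) z') =
  t *: prolong_dir b (ext m k q z) + prolong m k phi (ext m k q z).
Proof.
move=> k2 Op; have A := agree_ext_shift q z z' b t.
have Op' : O (ext m k (t *: ecoord (jix m k b) + q) z').
  by apply: (regular_agree _ _ _ _ _ _ _ _ Op) => //; exact: agreeW A.
have m0 : (0 < m)%N by have := ltn_ord b; lia.
apply: jcoordP => c cm; rewrite jcoord_line.
have -> : jcoord (prolong_dir b (ext m k q z)) c =
    \sum_(j < m) pderiv (jix m k b) (ytil m k phi k j) (ext m k q z) *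
    (c == jix m k j)%:R.
  rewrite jcoord_sum; apply: eq_bigr => j _; rewrite jcoordZ jcoord_ecoord //.
  by rewrite /jix; have := ltn_ord j; nia.
rewrite /jcoord !mxE inordK //; have [c0|c0] := eqVneq c 0%N.
  rewrite big1 ?mulr0 ?add0r; last by move=> j _; rewrite c0 mulr0.
  by apply: (dep_Xhat m k phi O) => //; apply: agree_sym; apply: agreeW A; lia.
have [r [i [im cE]]] : exists r i, (i < m)%N /\ c = jix m r i.
  exists (c.-1 %/ m)%N, (c.-1 %% m)%N; rewrite ltn_mod m0; split=> //.
  by rewrite /jix -addnA -divn_eq; lia.
have -> : c.-1 = (r * m + i)%N by rewrite cE /jix; lia.
rewrite divnMDl // divn_small // addn0 modnMDl modn_small //.
have rk : (r <= k)%N by move: cm; rewrite cE /jix; nia.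
case: (ltngtP r k) rk => // [rk _|rk _].
  rewrite big1 ?mulr0 ?add0r => [|j _].
    apply: (dep_ytil m k phi U oU sphi r i (leqW (ltnW rk))) => //.
    by apply: agree_sym; exact: agreeW A.
  rewrite (_ : (c == jix m k j) = false) ?mulr0 // cE /jix; nia.
rewrite (bigD1 (Ordinal im)) //= big1 ?addr0 => [|j]; last first.
  rewrite -val_eqE /= => ji.
  by rewrite (_ : (c == jix m k j) = false) ?mulr0 // cE rk /jix; lia.
rewrite cE rk eqxx mulr1 [RHS]addrC.
have k2' : (2 <= k <= k.+1)%N by lia.
have aY := affine_ytil_pderiv m k phi U oU sphi k i k2'.
exact: (affine_ext_shift _ _ q z z' b t k2 aY Op).
Qed.

End Extension.

(** * Second derivatives *)

(** In matrix form the hypothesis is A^T G A = s K with K = sum_a u_a F_a, so G = s A^(-T) K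
    A^(-1). *)
Lemma congruence_inv {R : realType} m (A : 'M[R]_m) (G : 'I_m -> 'I_m -> R)
    (u : 'I_m -> R) (F : 'I_m -> 'I_m -> 'I_m -> R) (s : R) :
  A \in unitmx ->
  (forall b c, \sum_l A l c * (\sum_j A j b * G j l) = s * \sum_a u a * F a b c) ->
  forall j l, G j l =
    s * \sum_a \sum_b \sum_c u a * F a b c * invmx A b j * invmx A c l.
Proof.
move=> uA E j l.
pose Gm := \matrix_(j, l) G j l; pose K := \matrix_(b, c) \sum_a u a * F a b c.
have EK : A^T *m Gm *m A = s *: K.
  apply/matrixP => b c; rewrite !mxE -E; apply: eq_bigr => l' _.
  rewrite mxE mulrC; congr (_ * _); apply: eq_bigr => j' _.
  by rewrite !mxE.
have -> : G j l = ((invmx A)^T *m (s *: K) *m invmx A) j l.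
  rewrite -EK !mulmxA -trmx_mul mulmxV // trmx1 mul1mx -mulmxA mulmxV // mulmx1.
  by rewrite mxE.
rewrite -scalemxAr -scalemxAl mxE; congr (_ * _); rewrite mxE.
under eq_bigr do rewrite mxE mulr_suml.
rewrite exchange_big [RHS]exchange_big /=; apply: eq_bigr => b _.
rewrite [RHS]exchange_big /=; apply: eq_bigr => c _.
rewrite !mxE mulr_sumr mulr_suml; apply: eq_bigr => a _; ring.
Qed.

Lemma derive_lincomb {R : realType} {V : normedModType R} n (s : 'I_n -> R)
    (F : 'I_n -> V -> R) x v : (forall i, differentiable (F i) x) ->
  derivable (\sum_(i < n) s i *: F i) x v /\
  'D_v (\sum_(i < n) s i *: F i) x = \sum_(i < n) s i * 'D_v (F i) x.
Proof.
move=> dF; have ds i : derivable (s i *: F i) x v.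
  by apply: derivableZ; exact: diff_derivable.
split; first exact: derivable_sum.
rewrite derive_sum //; apply: eq_bigr => i _.
by rewrite deriveZ //; exact: diff_derivable.
Qed.

Lemma smooth_on_differentiable {R : realType} {V : normedModType R} (O : set V)
  (h : V -> R) x : smooth_on O h -> O x -> differentiable h x.
Proof. by move=> sh Ox; have [dh _] := sh 1%N; exact: dh. Qed.

Lemma smooth_on_derive {R : realType} {V : normedModType R} (O : set V)
  (h : V -> R) v : smooth_on O h -> smooth_on O (fun x => derive h x v).
Proof. by move=> sh n; have [_] := sh n.+1; apply. Qed.

Section SecondDerivative.
Context {R : realType} (m k : nat) (phi : 'rV[R]_m.+1 -> 'rV[R]_m.+1).
Context (U : set 'rV[R]_m.+1).
Context (f g : nat -> 'rV[R]_(jdim m k) -> R) (W W' : set 'rV[R]_(jdim m k)).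
Local Notation O := (regular_jets m k phi U).
Local Notation D := (Dtot m k (Xhat m k phi)).
Local Notation pt q := (ext m k q (fun i => f i q)).
Local Notation P q := (prolong m k phi (pt q)).
Local Notation e a := (ecoord (jix m k a)).
Local Notation M l c p := (pderiv (jix m k c) (ytil m k phi k l) p).

Hypothesis k3 : (3 <= k)%N.
Hypothesis oU : open U.
Hypothesis sphi : forall c : 'I_m.+1, dsmooth U (fun b => phi b ord0 c).
Hypothesis oW : linewise_open W.
Hypothesis sf : forall i, (i < m)%N -> smooth_on W (f i).
Hypothesis sg : forall i, (i < m)%N -> smooth_on W' (g i).
Hypothesis WO : forall q, W q -> O (pt q).
Hypothesis WP : forall q, W q -> W' (P q).
Hypothesis fg : forall q i, W q -> (i < m)%N ->
  ytil m k phi k.+1 i (pt q) = g i (P q).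

Let k2 : (2 <= k)%N. Proof. exact: ltnW. Qed.

Lemma dep_pt_shift h q (b : 'I_m) t : dep m k O k h -> W q ->
  W (t *: e b + q) -> h (pt (t *: e b + q)) = h (pt q).
Proof.
move=> dh Wq Wt; apply/esym/dh; [exact: WO|exact: WO|].
exact: agree_ext_shift.
Qed.

Lemma derive_prolong_dir (h : 'rV[R]_(jdim m k) -> R) (b : 'I_m) q :
  differentiable h (P q) ->
  'D_(prolong_dir m k phi b (pt q)) h (P q) =
  \sum_(j < m) M j b (pt q) * pderiv (jix m k j) h (P q).
Proof.
move=> dh; rewrite deriveE // linear_sum; apply: eq_bigr => j _ /=.
rewrite linearZ /=; congr (_ * _); symmetry; exact: deriveE.
Qed.

(** [kap] is the slope in y_k^c of the affine remainder of ytil_(k+1). Only its independence of y_k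
    matters afterwards. It is fixed before q, so the identity holds on all of [W] and can be
    differentiated again. *)
Lemma first_derivative (i c : 'I_m) : exists2 kap, dep m k O k kap &
  forall q, W q ->
  \sum_(l < m) M l c (pt q) * pderiv (jix m k l) (g i) (P q) =
  kap (pt q) + \sum_(a < m) (M i a (pt q) / D (pt q)) * pderiv (jix m k c) (f a) q.
Proof.
have [K aK] := affine_Dlow_ytil m k phi U oU sphi i k3.
exists (K c); first by case: aK.
move=> q Wq; have Op := WO _ Wq.
(* The coefficients of f are frozen at q. They are constant along the line, so subtracting [S] from
   g(P q') leaves the remainder, which is affine in t. *)
pose S := \sum_(a < m) (M i a (pt q) / D (pt q)) *: f a.
have df (a : 'I_m) : differentiable (f a) q.
  by apply: smooth_on_differentiable Wq; exact: sf.
have [dS DS] := derive_lincomb m (fun a => M i a (pt q) / D (pt q))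
  (fun a : 'I_m => f a) q (e c) df.
pose F q' := g i (P q') - S q'.
have [dF DF] : derivable F q (e c) /\ 'D_(e c) F q = K c (pt q).
  apply: (derive_affine_line _ _ _ (Dlow m k k (ytil m k phi k i) (pt q) / D (pt q))).
  apply: filterS (oW q (e c) Wq) => t Wt.
  have Ot := WO _ Wt; rewrite /F -fg // (ytilS m k phi U oU sphi) //.
  rewrite (affine_ext_shift m k phi U oU _ _ _ _ _ _ _ k2 aK Op) -addrA.
  rewrite -[RHS]addr0; congr (_ + _); apply/eqP; rewrite subr_eq0; apply/eqP.
  rewrite /S fct_sumE; apply: eq_bigr => a _.
  rewrite jcoord_ext_top // mulrC [RHS]/(_ * _); congr (_ * _).
  apply: (dep_pt_shift (fun p => M i a p / D p)) => //.
  apply: (depW m k O k 2 _ k2); apply: depM.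
    by apply: dep_pderiv_ytil => //; lia.
  by apply: depV; exact: dep_DXhat.
rewrite -DF -DS -deriveD // -derive_prolong_dir; last first.
  by apply: smooth_on_differentiable (WP _ Wq); exact: sg.
apply: derive_line; apply: filterS (oW q (e c) Wq) => t Wt.
rewrite -(prolong_ext_shift m k phi U oU sphi _ _ (fun i => f i (t *: e c + q))) //.
by rewrite /F fctE subrK.
Qed.

(** Along y_k^b the coefficients and [kap] are constant and the prolonged point moves on a straight
    line, so differentiating the identity of [first_derivative] leaves only second derivatives of g
    and f. *)
Lemma second_derivative (i b c : 'I_m) q : W q ->
  \sum_(l < m) M l c (pt q) * (\sum_(j < m) M j b (pt q) * I2 m k g i j l (P q)) =
  \sum_(a < m) (M i a (pt q) / D (pt q)) * I2 m k f a b c q.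
Proof.
move=> Wq; have Op := WO _ Wq; have [kap dkap E] := first_derivative i c.
have := eq_on_derive oW _ _ q (e b) E Wq.
have dM l d : dep m k O k (fun p => M l (nat_of_ord (d : 'I_m)) p).
  by apply: (depW m k O k 2 _ k2); apply: dep_pderiv_ytil => //; lia.
have dg (l : 'I_m) : differentiable (pderiv (jix m k l) (g i)) (P q).
  by apply: smooth_on_differentiable (WP _ Wq); apply: smooth_on_derive; exact: sg.
have df (a : 'I_m) : differentiable (pderiv (jix m k c) (f a)) q.
  by apply: smooth_on_differentiable Wq; apply: smooth_on_derive; exact: sf.
have -> : 'D_(e b) (fun q => \sum_(l < m)
      M l c (pt q) * pderiv (jix m k l) (g i) (P q)) q =
    'D_(prolong_dir m k phi b (pt q)) (\sum_(l < m)
      M l c (pt q) *: pderiv (jix m k l) (g i)) (P q).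
  apply: derive_line; apply: filterS (oW q (e b) Wq) => t Wt.
  rewrite -(prolong_ext_shift m k phi U oU sphi _ _
    (fun i => f i (t *: e b + q)) _ _ k2 Op) fct_sumE.
  apply: eq_bigr => l _; rewrite [RHS]/(_ * _); congr (_ * _).
  exact: dep_pt_shift (dM l c) Wq Wt.
have -> : 'D_(e b) (fun q => kap (pt q) + \sum_(a < m)
      (M i a (pt q) / D (pt q)) * pderiv (jix m k c) (f a) q) q =
    'D_(e b) (cst (kap (pt q)) + \sum_(a < m)
      (M i a (pt q) / D (pt q)) *: pderiv (jix m k c) (f a)) q.
  apply: derive_line; apply: filterS (oW q (e b) Wq) => t Wt.
  rewrite fctE fct_sumE (dep_pt_shift _ _ _ _ dkap) //; congr (_ + _).
  apply: eq_bigr => a _; rewrite [RHS]/(_ * _); congr (_ * _).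
  apply: (dep_pt_shift (fun p => M i a p / D p)) => //.
  apply: depM; first exact: dM.
  by apply: (depW m k O k 2 _ k2); apply: depV; exact: dep_DXhat.
have [dS DS] := derive_lincomb m (fun a => M i a (pt q) / D (pt q))
  (fun a : 'I_m => pderiv (jix m k c) (f a)) q (e b) df.
have [_ DT] := derive_lincomb m (fun l => M l c (pt q))
  (fun l : 'I_m => pderiv (jix m k l) (g i)) _ (prolong_dir m k phi b (pt q)) dg.
rewrite DT deriveD; [|exact: derivable_cst|exact: dS].
rewrite derive_cst add0r DS => E'; rewrite -[RHS]E'.
by apply: eq_bigr => l _; rewrite derive_prolong_dir.
Qed.

End SecondDerivative.

(** Equivariance is tested on two systems matched by phi. The representation is that of pairs (d,
    A), with d nonzero and A invertible, acting on vector-valued bilinear forms S by d^(k-1) A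
    S(A^(-1), A^(-1)). *)
Theorem theorem3 (R : realType) (m k : nat)
  (hm : (2 <= m)%N) (hk : (3 <= k)%N)
  (phi psi : 'rV[R]_(m.+1) -> 'rV[R]_(m.+1)) (U V : set 'rV[R]_(m.+1))
  (f g : nat -> 'rV[R]_(jdim m k) -> R) (W W' : set 'rV[R]_(jdim m k)) :
  open U -> open V ->
  (forall c : 'I_m.+1, smooth_on U (fun b => phi b ord0 c)) ->
  (forall c : 'I_m.+1, smooth_on V (fun b => psi b ord0 c)) ->
  (forall b, U b -> V (phi b) /\ psi (phi b) = b) ->
  (forall b, V b -> U (psi b) /\ phi (psi b) = b) ->
  open W -> open W' ->
  (forall i, (i < m)%N -> smooth_on W (f i)) ->
  (forall i, (i < m)%N -> smooth_on W' (g i)) ->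
  (forall q, W q -> U (base m k q)) ->
  (forall q, W q -> Dtot m k (Xhat m k phi) (ext m k q (fun i => f i q)) != 0) ->
  (forall q, W q -> W' (prolong m k phi (ext m k q (fun i => f i q)))) ->
  (forall q i, W q -> (i < m)%N ->
     ytil m k phi k.+1 i (ext m k q (fun i => f i q))
     = g i (prolong m k phi (ext m k q (fun i => f i q)))) ->
  forall q, W q -> forall i j l : 'I_m,
    let p := ext m k q (fun i => f i q) in
    let J := Jmx m k phi p in
    I2 m k g i j l (prolong m k phi p)
    = Dtot m k (Xhat m k phi) p ^+ k.-1 *
      \sum_(a < m) \sum_(b < m) \sum_(c < m)
        J i a * I2 m k f a b c q * invmx J b j * invmx J c l.
Proof.
move=> oU oV sphi spsi phiK psiK oW oW' sf sg WU WD WP fg q Wq i j l p J.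
have dphi c : dsmooth U (fun b => phi b ord0 c) by exact: smooth_on_dsmooth.
have WO q' : W q' -> regular_jets m k phi U (ext m k q' (fun i => f i q')).
  by move=> Wq'; split; [rewrite base_ext; exact: WU|exact: WD].
have Op : regular_jets m k phi U p by exact: WO.
have [Up D0] := Op; have [Vp _] := phiK _ Up.
have uJ : J \in unitmx.
  apply: (Jmx_unit m k phi psi U) => //.
  - exact: open_linewise_open.
  - by move=> b /phiK[].
  - by move=> c; exact: smooth_on_differentiable (sphi c) Up.
  - by move=> c; exact: smooth_on_differentiable (spsi c) Vp.
apply: (congruence_inv m J (fun j l => I2 m k g i j l (prolong m k phi p))
  (fun a => J i a) (fun a b c => I2 m k f a b c q)) => // b c.
have := second_derivative m k phi U f g W W' hk oU dphi (open_linewise_open _ oW)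
  sf sg WO WP fg i b c q Wq.
rewrite -/p; set d := Dtot m k (Xhat m k phi) p in D0 *.
have ME (l' a : 'I_m) : pderiv (jix m k a) (ytil m k phi k l') p = J l' a / d ^+ k.
  by apply: pderiv_ytil Op => //; lia.
under eq_bigr => l' _.
  rewrite ME; under eq_bigr do rewrite ME -mulrA mulrCA.
  rewrite -mulr_sumr; over.
under [in X in _ = X]eq_bigr do rewrite ME.
move=> E.
have dk : d ^+ k != 0 by rewrite expf_neq0.
(* Multiplying by d^(2k) clears the two factors d^(-k) on the side of g; on the side of f it meets
   d^k from the top coefficient and one more d, leaving d^(k-1). *)
have dk1 : d ^+ k = d * d ^+ k.-1 by rewrite -exprS prednK //; lia.
transitivity (d ^+ k * d ^+ k * (\sum_(l' < m) J l' c / d ^+ k *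
   (d ^- k * (\sum_(j' < m) J j' b * I2 m k g i j' l' (prolong m k phi p))))).
  by rewrite mulr_sumr; apply: eq_bigr => l' _; field.
rewrite E !mulr_sumr; apply: eq_bigr => a _; rewrite dk1; field.
by rewrite D0 expf_neq0.
Qed.
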